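(* There exist a constant $c$ and an integer $n_0$ such that the following holds. Let $G$ be an $n$-vertex graph, where $n \geq n_0$ is odd. If $\kappa(G) \geq c \max\{\alpha(G), \log n\}$ or $\kappa(G) \geq c\, \alpha(G)^2$, then $\mathcal{C}_n(G) = \mathcal{C}(G)$.
   Context: Graphs are finite and simple. $\kappa(G)$ is the vertex-connectivity of $G$ and $\alpha(G)$ is its independence number (maximum size of an independent set). $\log$ is the natural logarithm. The cycle space $\mathcal{C}(G)$ is the vector space over $\mathbb{F}_2$ spanned by the incidence vectors (in $\mathbb{F}_2^{E(G)}$) of the edge-sets of all cycles of $G$. If $G$ has $n$ vertices, $\mathcal{C}_n(G)$ is the subspace of $\mathcal{C}(G)$ spanned by the incidence vectors of the edge-sets of cycles of length $n$ in $G$, i.e. of Hamilton cycles of $G$. *)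

(* Defs.v *)
From mathcomp Require Import all_boot all_order all_algebra.

Set Implicit Arguments.
Unset Strict Implicit.
Unset Printing Implicit Defensive.

Import GRing.Theory.
Local Open Scope ring_scope.

(* A graph is a finType [T] of vertices with an adjacency relation [e], which
   the theorem assumes symmetric and irreflexive. *)

Section Graph.

Variables (T : finType) (e : rel T).

Definition edges : {set {set T}} :=
  [set [set xy.1; xy.2] | xy in [set xy : T * T | e xy.1 xy.2]].

Definition edge : finType := {f : {set T} | f \in edges}.

Definition independent (S : {set T}) : bool :=
  [forall x in S, forall y in S, ~~ e x y].

Definition independence_number : nat :=
  (\max_(S : {set T} | independent S) #|S|)%N.

Definition connected_minus (S : {set T}) : bool :=
  [forall x in ~: S, forall y in ~: S, connect [rel u v in ~: S | e u v] x y].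

Definition k_connected (k : nat) : bool :=
  (k < #|T|)%N && [forall S : {set T}, (#|S| < k)%N ==> connected_minus S].

(* The greatest [k] such that the graph is [k]-connected; in particular the
   complete graph on [n] vertices has connectivity [n - 1]. *)
Definition connectivity : nat := (\max_(k < #|T| | k_connected k) k)%N.

Definition incidence_vector (C : {set {set T}}) : {ffun edge -> ('F_2)^o} :=
  [ffun f : edge => (val f \in C)%:R].

Definition cycle_edges (p : seq T) : {set {set T}} :=
  [set [set x; next p x] | x in p].

(* [ucycleb e p] also holds for sequences of fewer than three vertices, which
   are not cycles of a simple graph. *)
Definition cycles_of_length (k : nat) : {set {set {set T}}} :=
  [set cycle_edges p | p : k.-tuple T & (2 < k)%N && ucycleb e p].

(* The vertices of a cycle are distinct, so its length is at most [#|T|]. *)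
Definition cycles : {set {set {set T}}} :=
  \bigcup_(k < #|T|.+1) cycles_of_length k.

Definition cycle_space : {vspace {ffun edge -> ('F_2)^o}} :=
  <<[seq incidence_vector C | C in cycles]>>%VS.

Definition cycle_space_of_length (k : nat) : {vspace {ffun edge -> ('F_2)^o}} :=
  <<[seq incidence_vector C | C in cycles_of_length k]>>%VS.

End Graph.

(* Main.v *)
Require Import Defs.
From mathcomp Require Import all_boot all_order all_algebra.
From mathcomp Require Import reals exp zify.

(** Write [alpha] and [kappa] for the independence number and the connectivity.
Since [alpha >= 1], either hypothesis with [c = 20] gives
[20 * alpha <= kappa], and the argument starts from this inequality.

By duality it suffices to take a weight [w] on the edges, with values in F_2,
whose sum over every Hamilton cycle is 0, and to show that its sum over every
cycle is 0 ([functional_separation], [closed_walk_sum0]). The weights are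
booleans, added with [addb].

The engine is the Chvatal-Erdos argument. Among more than [alpha] vertices on a
path or a cycle there are two, y and z, whose successors y' and z' are adjacent
([adjacent_successors]). If v is a vertex off a cycle D and y, z are neighbours
of v, then replacing yy' and zz' by yv, vz and y'z' absorbs v into D
([insert_vertex]); with a path in place of v the same exchange makes any two
vertices the ends of a Hamilton path, even after a small set of vertices has
been deleted ([ham_path]).

Absorbing v changes the sum of D by the sum of the closed walk v y y' z' z, a
pentagon or, when y' = z, a triangle. The main point is that this change is a
number tau(v) which does not depend on D. Take a triangle v x x' away from the
pentagon; it exists because v has far more than [alpha] neighbours. Two short
paths and a Hamilton path of what remains give a Hamilton cycle of G - v through
xx', yy' and zz' in a suitable order, and v can be absorbed into it both at xx'
and by the exchange. Both results are Hamilton cycles of G, of sum 0, so the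
triangle and the pentagon have the same sum ([pentagon_triangle]). Absorbing the
vertices of a small set W one by one, a Hamilton cycle of G - W has sum equal to
the sum of tau over W ([almost_spanning_cycle_sum]).

Now let C be a short cycle, zz' an edge of C, and W the other vertices of C. A
Hamilton path of G - W from z' to z can be closed by the edge zz', or by the
rest of C, which yields a Hamilton cycle of G. Comparing the two shows that the
sum of C is the sum of tau over W ([short_cycle_sum]). This holds for every edge
zz' of C, so tau agrees on two vertices of C with a common neighbour on C.
Because short cycles exist through any two edges at a vertex, and because every
vertex lies in a triangle, tau is a constant t ([tau_const]).

Hence w + t has sum 0 on short cycles, so on short closed walks. Any vertex is
within distance [2 * alpha] of a fixed root, so w + t is the coboundary of its
sums along short paths from the root, and it has sum 0 on every cycle. On a
Hamilton cycle, whose length n is odd, this sum is n * t = t. Thus t = 0, and w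
has sum 0 on every cycle. *)

Set Implicit Arguments.
Unset Strict Implicit.
Unset Printing Implicit Defensive.

(** * Sums along walks *)

Section WalkSums.

Variables (T : eqType) (w : T -> T -> bool).

Fixpoint walk_sum (x : T) (p : seq T) : bool :=
  if p is y :: q then w x y (+) walk_sum y q else false.

Definition cycle_sum (p : seq T) : bool :=
  if p is x :: q then walk_sum x (rcons q x) else false.

Lemma walk_sum_cat x p q :
  walk_sum x (p ++ q) = walk_sum x p (+) walk_sum (last x p) q.
Proof. by elim: p x => //= y p IHp x; rewrite IHp addbA. Qed.

Lemma walk_sum_rcons x p y :
  walk_sum x (rcons p y) = walk_sum x p (+) w (last x p) y.
Proof. by rewrite -cats1 walk_sum_cat /= addbF. Qed.

Lemma cycle_sum_rcons x p : cycle_sum (rcons p x) = cycle_sum (x :: p).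
Proof.
case: p => //= y p.
by rewrite !walk_sum_rcons !last_rcons addbC.
Qed.

Lemma cycle_sum_catC p q : cycle_sum (p ++ q) = cycle_sum (q ++ p).
Proof.
elim: p q => [|x p IHp] q; first by rewrite cats0.
by rewrite cat_cons -cycle_sum_rcons rcons_cat IHp cat_rcons.
Qed.

Hypothesis wC : symmetric w.

Lemma walk_sum_rev x p :
  walk_sum (last x p) (rev (belast x p)) = walk_sum x p.
Proof.
elim: p x => //= y p IHp x; rewrite rev_cons walk_sum_rcons IHp.
suff -> : last (last y p) (rev (belast y p)) = y by rewrite addbC wC.
by case: p {IHp} => //= z p; rewrite rev_cons last_rcons.
Qed.

Lemma cycle_sum_next p : uniq p ->
  \big[addb/false]_(x <- p) w x (next p x) = cycle_sum p.
Proof.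
case: p => [|x p]; first by rewrite big_nil.
move=> Up.
have gen q y : uniq (y :: q) ->
   \big[addb/false]_(z <- y :: q) w z (next_at z x y q) = walk_sum y (rcons q x).
  elim: q y => [|z q IHq] y /=; first by rewrite big_seq1 /= eqxx addbF.
  case/andP=> ynzq Uzq; rewrite big_cons /= eqxx; congr (_ (+) _).
  rewrite -IHq //; apply: eq_big_seq => u uzq.
  by case: eqP => // eq_uy; rewrite -eq_uy uzq in ynzq.
exact: gen.
Qed.

End WalkSums.

Lemma walk_sum_shift (T : eqType) (w : T -> T -> bool) t x p :
  walk_sum (fun u v => w u v (+) t) x p =
  walk_sum w x p (+) (odd (size p) && t).
Proof.
elim: p x => //= y p IHp x; rewrite IHp.
by case: (w x y); case: (walk_sum w y p); case: (odd _); case: (t).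
Qed.

(* Identities between sums are checked by truth table, with the weights and the
   sums along walks as atoms. *)
Ltac xor_cases w :=
  repeat match goal with
  | |- context [walk_sum w ?x ?p] => generalize (walk_sum w x p)
  | |- context [w ?x ?y] => generalize (w x y)
  end; by do ![case].


Lemma not_uniq_split (T : eqType) (p : seq T) : ~~ uniq p ->
  exists A x B C, p = A ++ (x :: B) ++ x :: C.
Proof.
elim: p => //= x p IHp; case: (boolP (x \in p)) => /= [|_ /IHp].
  by case/splitPr => B C _; exists [::], x, B, C.
by case=> A [y [B [C ->]]]; exists (x :: A), y, B, C.
Qed.

Lemma last_take (T : eqType) (x : T) s n :
  n <= size s -> last x (take n s) = nth x (x :: s) n.
Proof.
move=> ns; rewrite (last_nth x) size_takel //.
by rewrite -[x :: take n s]/(take n.+1 (x :: s)) nth_take.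
Qed.

(** * Short paths and Hamilton paths *)

Section HighlyConnected.

Variables (T : finType) (e : rel T).
Hypotheses (e_sym : symmetric e) (e_irr : irreflexive e).

Variables (a k : nat).
Hypothesis indep_le : forall S, independent e S -> #|S| <= a.
Hypothesis conn : forall S : {set T}, #|S| < k -> connected_minus e S.
Hypothesis k_lt : k < #|T|.
(* Below, fewer than 4a + 9 vertices are deleted at any time, and exchanges need
   slightly more than a further vertices of the neighbourhoods. As a >= 1, the
   constant 20 leaves room for all this. *)
Hypothesis ak : 20 * a <= k.

Lemma edge_neq x y : e x y -> x != y.
Proof. by apply: contraTneq => ->; rewrite e_irr. Qed.

Lemma indep_gt0 : 0 < a.
Proof.
have /card_gt0P[x _] : 0 < #|T| by lia.
rewrite -(cards1 x); apply: indep_le; apply/forall_inP => u /set1P ->.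
by apply/forall_inP => v /set1P ->; rewrite e_irr.
Qed.

Lemma dense_edge (S : {set T}) : a < #|S| ->
  exists x y, [/\ x \in S, y \in S & e x y].
Proof.
rewrite ltnNge => /(contraNN (@indep_le S)).
case/forall_inPn => x xS /forall_inPn[y yS]; rewrite negbK => exy.
by exists x, y.
Qed.

(** The successors of the elements of [Y] are distinct, so there are too many of
them to be independent. Here [last s A] and [last y' B] are the elements of [Y]
whose successors [y'] and [z'] are adjacent. When [B] is empty, these successors
are consecutive on the path. *)
Lemma adjacent_successors s p (Y : {set T}) :
    uniq (s :: p) -> {subset Y <= s :: p} -> last s p \notin Y -> a < #|Y| ->
  exists A y' B z' C, [/\ p = A ++ (y' :: B) ++ z' :: C, last s A \in Y,
    last y' B \in Y & e y' z'].
Proof.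
move=> Up Ysub lastY aY.
pose i y := index y (s :: p); pose f y := nth s p (i y).
have i_lt y : y \in Y -> i y < size p.
  move=> yY; have /(_ _ yY) := Ysub; rewrite -index_mem /= ltnS leq_eqVlt.
  case/orP => // /eqP ieq; case/negP: lastY.
  by rewrite (last_nth s) -ieq nth_index // Ysub.
have nth_i y : y \in Y -> nth s (s :: p) (i y) = y.
  by move=> yY; rewrite nth_index ?Ysub.
have i_inj : {in Y &, injective i}.
  by move=> y z yY zY eq_i; rewrite -(nth_i y yY) eq_i nth_i.
have f_inj : {in Y &, injective f}.
  move=> y z yY zY /eqP; case/andP: Up => _ Up.
  by rewrite nth_uniq ?i_lt // => /eqP /i_inj; apply.
have := @dense_edge (f @: Y); rewrite card_in_imset // => /(_ aY).
case=> _ [_ [/imsetP[y yY ->] /imsetP[z zY ->]]].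
wlog lt_yz : y z yY zY / i y < i z.
  move=> wl efyz; case: (ltngtP (i y) (i z)) => [lt|lt|eq_i].
  - exact: wl efyz.
  - by apply: (wl z y) => //; rewrite e_sym.
  - by rewrite (i_inj _ _ yY zY eq_i) e_irr in efyz.
move=> efyz.
have iy := i_lt y yY; have iz := i_lt z zY.
exists (take (i y) p), (f y), (drop (i y).+1 (take (i z) p)), (f z),
  (drop (i z).+1 p).
have dropE : f y :: drop (i y).+1 (take (i z) p) = drop (i y) (take (i z) p).
  by rewrite (drop_nth s (n := i y)) ?nth_take // size_takel // ltnW.
split=> //.
- rewrite dropE -drop_nth // catA.
  have -> : take (i y) p = take (i y) (take (i z) p) by rewrite take_takel // ltnW.
  by rewrite !cat_take_drop.
- by rewrite last_take ?nth_i // ltnW.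
- have -> : last (f y) (drop (i y).+1 (take (i z) p)) = z; last by [].
  have -> : last (f y) (drop (i y).+1 (take (i z) p)) =
            last s (f y :: drop (i y).+1 (take (i z) p)) by [].
  rewrite dropE -[RHS](nth_i z zY).
  have -> : last s (drop (i y) (take (i z) p)) =
            last s (take (i y) (take (i z) p) ++ drop (i y) (take (i z) p)).
    by rewrite last_cat -dropE.
  by rewrite cat_take_drop last_take // ltnW.
Qed.

Lemma connect_avoid (X : seq T) x y : size X < k -> x \notin X -> y \notin X ->
  connect [rel u v | [&& u \notin X, v \notin X & e u v]] x y.
Proof.
move=> Xk xX yX; have /conn : #|[set z in X]| < k.
  by rewrite cardsE; apply: leq_ltn_trans (card_size X) Xk.
move/forall_inP/(_ x); rewrite !inE => /(_ xX) /forall_inP /(_ y).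
rewrite !inE => /(_ yX); rewrite (@eq_connect _ _
  [rel u v | [&& u \notin X, v \notin X & e u v]]) //.
by move=> u v /=; rewrite !inE andbA.
Qed.

Lemma path_avoid (X : seq T) x p :
  x \notin X ->
  path [rel u v | [&& u \notin X, v \notin X & e u v]] x p =
  path e x p && all [predC X] (x :: p).
Proof.
elim: p x => [|y p IHp] x xX /=; first by rewrite xX.
rewrite xX /=; case: (boolP (y \in X)) => [yX|yX] /=; first by rewrite !andbF.
by rewrite IHp //= yX !andbA.
Qed.

(** On a shortest path the vertices in even positions are pairwise nonadjacent,
because an edge between two of them would be a shortcut. *)
Lemma short_path (X : seq T) x y : size X < k -> x \notin X -> y \notin X ->
  exists p, [/\ path e x p, last x p = y, uniq (x :: p),
    all [predC X] (x :: p) & size (x :: p) <= a.*2].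
Proof.
move=> Xk xX yX; set r := [rel u v | [&& u \notin X, v \notin X & e u v]].
pose P n := [exists p : n.-tuple T, path r x p && (last x p == y)].
have exP : exists n, P n.
  have /connectP[p rp yp] := connect_avoid Xk xX yX.
  by exists (size p); apply/existsP; exists (in_tuple p); rewrite /= rp yp eqxx.
case: (ex_minnP exP) => n /existsP[p /andP[rp /eqP lp]] nmin.
have {}nmin q : path r x q -> last x q = y -> size p <= size q.
  move=> rq lq; rewrite size_tuple; apply: nmin; apply/existsP.
  by exists (in_tuple q); rewrite /= rq lq eqxx.
move: (tval p) rp lp nmin => {n exP P} {}p rp lp.
case/shortenP: rp lp => q rq Uq sub_q lq nmin.
have {sub_q}qp : size q <= size p by apply: uniq_leq_size; [case/andP: Uq|].
have {nmin qp}nmin q' : path r x q' -> last x q' = y -> size q <= size q'.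
  by move=> rq' lq'; apply: leq_trans qp (nmin q' rq' lq').
exists q; move: (rq); rewrite path_avoid // => /andP[eq Xq]; split=> //.
rewrite /= ltnNge; apply/negP => aq.
pose f (i : 'I_a.+1) := nth x (x :: q) i.*2.
have f_lt (i : 'I_a.+1) : i.*2 < size (x :: q).
  by rewrite /=; have := ltn_ord i; lia.
have f_inj : injective f.
  move=> i j /eqP; rewrite nth_uniq // => /eqP ij; apply: val_inj => /=.
  by apply: double_inj.
have := @dense_edge (f @: setT).
rewrite card_imset // cardsT card_ord ltnSn => /(_ isT).
case=> _ [_ [/imsetP[i _ ->] /imsetP[j _ ->]]].
wlog lt_ij : i j / i < j.
  move=> wl eij; case: (ltngtP i j) => [lt|lt|/val_inj eq_ij].
  - exact: wl eij.
  - by apply: (wl j i) => //; rewrite e_sym.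
  - by rewrite eq_ij e_irr in eij.
have fX l : f l \notin X by apply: (allP Xq); apply: mem_nth.
have j_gt0 : 0 < j.*2 by lia.
have j_le : j.*2.-1 < size q by have := f_lt j; rewrite /=; lia.
have i_le : i.*2 <= size q by have := f_lt i.
have last_i : last x (take i.*2 q) = f i by rewrite last_take.
have fj : nth x q j.*2.-1 = f j by rewrite /f -[in RHS](prednK j_gt0).
move=> eij; pose q' := take i.*2 q ++ drop j.*2.-1 q.
have := nmin q'; rewrite /q' (drop_nth x) // cat_path last_i last_cat /= fj.
have -> : last (f j) (drop j.*2.-1.+1 q) = y.
  by have := lq; rewrite -{1}(cat_take_drop j.*2.-1 q) (drop_nth x) // last_cat /= fj.
have := rq; rewrite -{1}(cat_take_drop i.*2 q) cat_path => /andP[-> _].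
have := rq; rewrite -{1}(cat_take_drop j.*2.-1 q) cat_path (drop_nth x) //=.
rewrite fj => /and3P[_ _ ->]; rewrite !fX eij /= => /(_ isT erefl).
by rewrite size_cat /= size_takel // size_drop; have := f_lt j; rewrite /=; lia.
Qed.

Lemma rev_consE (x : T) p : rev (x :: p) = last x p :: rev (belast x p).
Proof. by rewrite lastI rev_rcons. Qed.

Lemma last_rev_belast (x : T) p : last (last x p) (rev (belast x p)) = x.
Proof. by case: p => //= y p; rewrite rev_cons last_rcons. Qed.

Lemma rev_path_sym x p : path e (last x p) (rev (belast x p)) = path e x p.
Proof. by rewrite rev_path; apply: eq_path => u v; rewrite e_sym. Qed.

(** The exchange of Chvatal and Erdos: the path leaves the old one after
[last s A], visits [h :: q], comes back at [last y' B], runs backwards to [y'],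
and takes the chord from [y'] to [z']. *)
Lemma splice_path s A h q y' B z' C :
    path e s (A ++ (y' :: B) ++ z' :: C) -> path e h q ->
    e (last s A) h -> e (last h q) (last y' B) -> e y' z' ->
  path e s (A ++ (h :: q) ++ rev (y' :: B) ++ z' :: C).
Proof.
rewrite rev_consE !cat_path /= last_rev_belast rev_path_sym.
by case/and4P=> -> /andP[_ ->] _ -> -> -> -> ->.
Qed.

Lemma splice_perm s A h q y' B z' (C : seq T) :
  perm_eq (s :: A ++ (h :: q) ++ rev (y' :: B) ++ z' :: C)
    ((h :: q) ++ s :: A ++ (y' :: B) ++ z' :: C).
Proof.
rewrite -!cat_cons perm_catCA perm_cat2l perm_cat2l perm_cat2r.
by apply/permPl/perm_rev.
Qed.

Lemma degree_ge v : k <= #|[set y | e v y]|.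
Proof.
rewrite leqNgt; apply/negP => Nk.
have [u] : exists u, u \notin v |: [set y | e v y].
  apply/existsP; apply: contraT; rewrite negb_exists => /forallP allN.
  have : #|T| <= #|v |: [set y | e v y]|.
    by rewrite -cardsT subset_leq_card //; apply/subsetP => x _; have := allN x; rewrite negbK.
  have := cardsU1 v [set y | e v y]; have := leq_b1 (v \notin [set y | e v y]).
  by move: Nk k_lt; lia.
rewrite !inE negb_or => /andP[uv nevu].
have /forall_inP/(_ v) := conn Nk; rewrite !inE e_irr => /(_ isT).
move=> /forall_inP/(_ u); rewrite !inE => /(_ nevu) /connectP[[|x p] /=].
  by move=> _ uvE; rewrite uvE eqxx in uv.
by rewrite !inE => /andP[]; case: (e v x); rewrite ?andbF.
Qed.

(** Let H be the component of [v] off [X] and the path. If the neighbours of H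
on the path, together with [X], separate H from the rest, there are at least
[k - size X] of them, and two have adjacent successors, between which H can be
visited by an exchange. Otherwise every vertex of the path has a neighbour in H,
and H can be visited between the first two. *)
Lemma extend_path (X : seq T) s p v :
    size X + a + 2 <= k -> path e s p -> uniq (s :: p) ->
    all [predC X] (s :: p) -> s != last s p -> v \notin X -> v \notin s :: p ->
  exists p', [/\ path e s p', last s p' = last s p, uniq (s :: p'),
    all [predC X] (s :: p') & size p < size p'].
Proof.
move=> Xk ep Up Xp s_last vX vp.
pose Z := X ++ s :: p.
pose r := [rel x y | [&& x \notin Z, y \notin Z & e x y]].
have vZ : v \notin Z by rewrite mem_cat negb_or vX.
have rZ h : connect r v h -> h \notin Z.
  case/connectP => q; rewrite path_avoid // => /andP[_ /allP Zq] ->.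
  exact: Zq (mem_last v q).
have r_sym : symmetric r by move=> x y; rewrite /= andbCA e_sym.
pose N := [set y in s :: p | [exists h, connect r v h && e y h]].
(* The component H of [v] is { h | connect r v h }, and N is its set of
   neighbours on the path. *)
have detour y z : y \in N -> z \in N -> exists h q,
    [/\ path e h q, uniq (h :: q), all [predC Z] (h :: q), e y h & e (last h q) z].
  rewrite !inE => /andP[_ /existsP[h /andP[vh eyh]]].
  case/andP => _ /existsP[h' /andP[vh' ezh']].
  have : connect r h h' by apply: connect_trans vh'; rewrite sym_connect_sym.
  case/connectP => q0 /shortenP[q rq Uq _] h'E; exists h, q; move: rq.
  by rewrite path_avoid ?rZ // => /andP[? ?]; split=> //; rewrite -h'E e_sym.
have splice A y' B z' C h q : p = A ++ (y' :: B) ++ z' :: C ->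
    path e h q -> uniq (h :: q) -> all [predC Z] (h :: q) ->
    e (last s A) h -> e (last h q) (last y' B) -> e y' z' ->
  exists p', [/\ path e s p', last s p' = last s p, uniq (s :: p'),
    all [predC X] (s :: p') & size p < size p'].
  move=> pE eq Uq Zq e1 e2 e3; exists (A ++ (h :: q) ++ rev (y' :: B) ++ z' :: C).
  have pp := splice_perm s A h q y' B z' C; rewrite -pE in pp.
  split.
  - by apply: splice_path; rewrite -?pE.
  - by rewrite pE !last_cat.
  - rewrite (perm_uniq pp) cat_uniq Uq Up andbT.
    apply/hasPn => x xp; apply/negP => /(allP Zq).
    by rewrite /= mem_cat xp orbT.
  - rewrite (perm_all _ pp) all_cat Xp andbT.
    by apply/allP => x /(allP Zq); rewrite /= mem_cat negb_or => /andP[].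
  - by rewrite pE !size_cat size_rev ltn_add2l addSn ltnS leq_addl.
case: (ltnP (size X + #|N|) k) => [XNk|kXN].
  have allN u : u \in s :: p -> u \in N.
    move=> up; apply: contraT => uN.
    have /connect_avoid : size (X ++ enum N) < k by rewrite size_cat -cardE.
    have vN : v \notin N by rewrite inE (negbTE vp).
    move=> /(_ v u); rewrite !mem_cat !mem_enum !negb_or vX vN uN.
    have -> : u \notin X by apply: (allP Xp).
    move=> /(_ isT isT) /connectP[q]; rewrite path_avoid; last first.
      by rewrite mem_cat mem_enum negb_or vX.
    case/andP=> eq XNq uE; suff: connect r v u by move/rZ; rewrite mem_cat up orbT.
    suff gen x : path e x q -> all [predC X ++ enum N] (x :: q) ->
        u = last x q -> connect r v x -> connect r v u.
      exact: gen eq XNq uE (connect0 _ _).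
    elim: q x {eq XNq uE} => /= [|y q IHq] x; first by move=> _ _ ->.
    case/andP=> exy eq /and3P[xXN yXN allq] uE vx.
    apply: (IHq y) => //=; first by rewrite yXN.
    have yZ : y \notin Z.
      move: yXN; rewrite /Z !mem_cat mem_enum => /norP[/negbTE-> yN] /=.
      apply: contraNN yN => yp; rewrite inE yp.
      by apply/existsP; exists x; rewrite vx e_sym.
    apply: (connect_trans vx); apply: connect1.
    by rewrite /r /= (rZ x vx) yZ.
  case: p ep Up Xp s_last vp @Z @r vZ rZ r_sym @N detour splice XNk allN => [|y p].
    by rewrite /= eqxx.
  move=> ep Up Xp s_last vp Z r vZ rZ r_sym N detour _ _ allN.
  have [||h [q [eq Uq Zq esh ely]]] := detour s y.
  - by apply: allN; rewrite mem_head.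
  - by apply: allN; rewrite inE mem_head orbT.
  case/andP: ep => esy ep; exists ((h :: q) ++ y :: p); split.
  - by rewrite /= esh cat_path eq /= ely.
  - by rewrite /= last_cat.
  - have /perm_uniq-> : perm_eq (s :: (h :: q) ++ y :: p) ((h :: q) ++ s :: y :: p).
      exact/permPl/(perm_catCA [:: s] (h :: q) (y :: p)).
    rewrite cat_uniq Uq Up andbT; apply/hasPn => x xp; apply/negP => /(allP Zq).
    by rewrite /= mem_cat xp orbT.
  - apply/allP => x; rewrite in_cons mem_cat => /or3P[xs|/(allP Zq)|xp].
    + by apply: (allP Xp); rewrite in_cons xs.
    + by rewrite /= mem_cat negb_or => /andP[].
    + by apply: (allP Xp); rewrite in_cons xp orbT.
  - by rewrite size_cat addSn ltnS leq_addl.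
have := @adjacent_successors s p (N :\ last s p) Up.
case=> [y|||A [y' [B [z' [C [pE yN zN eyz]]]]]].
- by rewrite !inE => /and3P[].
- by rewrite !inE eqxx.
- by have := cardsD1 (last s p) N; lia.
have [||h [q [eq Uq Zq e1 e2]]] := detour (last s A) (last y' B).
- by case/setD1P: yN.
- by case/setD1P: zN.
exact: splice pE eq Uq Zq e1 e2 eyz.
Qed.

(** A longest path from [s] to [t] off [X] cannot be extended, so it covers
everything. *)
Lemma ham_path (X : seq T) s t :
    size X + a + 2 <= k -> s \notin X -> t \notin X -> s != t ->
  exists p, [/\ path e s p, last s p = t, uniq (s :: p) & s :: p =i [predC X]].
Proof.
move=> Xk sX tX st.
pose P n := [exists p : n.-tuple T,
  [&& path e s p, last s p == t, uniq (s :: p) & all [predC X] (s :: p)]].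
have inP p : path e s p -> last s p = t -> uniq (s :: p) ->
    all [predC X] (s :: p) -> P (size p).
  move=> ep lp Up Xp; apply/existsP; exists (in_tuple p).
  by rewrite ep Up Xp andbT /= lp eqxx.
have exP : exists n, P n.
  have [|p [ep lp Up Xp _]] := short_path _ sX tX; first by lia.
  by exists (size p); apply: inP.
have Pmax n : P n -> n <= #|T|.
  case/existsP => p /and4P[_ _ /card_uniqP Up _].
  by have := max_card (mem (s :: p)); rewrite Up /= size_tuple; lia.
case: (ex_maxnP exP Pmax) => n /existsP[p /and4P[ep /eqP lp Up Xp]] nmax.
exists p; split=> // v; apply/idP/idP => [/(allP Xp) //|vX].
apply: contraT => vp.
have := @extend_path X s p v Xk ep Up Xp; rewrite lp => /(_ st vX vp).
case=> p' [ep' lp' Up' Xp' lt_p].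
by move: lt_p; rewrite size_tuple ltnNge nmax //; apply: inP.
Qed.

(** * Absorbing vertices *)

Lemma triangle_avoiding (X : seq T) v : size X + a < k ->
  exists x x', [/\ e v x, e v x', e x x', x \notin X & x' \notin X].
Proof.
move=> Xk; have [|x [x' []]] := @dense_edge ([set y | e v y] :\: [set y in X]).
  have := degree_ge v; rewrite -(cardsID [set y in X] [set y | e v y]).
  have : #|[set y | e v y] :&: [set y in X]| <= size X.
    apply: leq_trans (card_size X); rewrite subset_leq_card //.
    by apply/subsetP => x; rewrite !inE => /andP[].
  by lia.
by rewrite !inE => /andP[xX evx] /andP[x'X evx'] exx'; exists x, x'.
Qed.

Section NullHamiltonCycles.

Variable w : T -> T -> bool.
Hypothesis wC : symmetric w.
Hypothesis ham0 : forall p,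
  cycle e p -> uniq p -> size p = #|T| -> cycle_sum w p = false.

Lemma spanning_cycle_sum p :
  cycle e p -> uniq p -> (forall v, v \in p) -> cycle_sum w p = false.
Proof.
move=> ep Up pT; apply: ham0 => //.
by rewrite -(card_uniqP Up); apply: eq_card.
Qed.

(** The closed walk by which the exchange that absorbs [v] alters a cycle. The
case [y' = z], when the walk is the triangle [v y z] with the edge [z z']
traversed back and forth, is allowed on purpose: it occurs when the two
neighbours of [v] are consecutive on the cycle. *)
Definition pentagon v y y' z' z : bool :=
  [&& e v y, e y y', e y' z', e z' z, e z v, uniq [:: v; y; y'; z']
    & z \notin [:: v; y; z']].

Definition pentagon_sum v y y' z' z : bool :=
  cycle_sum w [:: v; y; y'; z'; z].

Lemma splice_sum s A h y' B z' C :
  walk_sum w s (A ++ h :: rev (y' :: B) ++ z' :: C) =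
  walk_sum w s (A ++ (y' :: B) ++ z' :: C) (+)
    pentagon_sum h (last s A) y' z' (last y' B).
Proof.
rewrite rev_consE !walk_sum_cat /= !walk_sum_cat /= last_rev_belast.
rewrite walk_sum_rev // /pentagon_sum /= !(wC h) (wC z').
xor_cases w.
Qed.

(** There is a cycle D through all vertices but [v] that passes, in this order,
through the edges [x x'], [y y'] and [z z']: the paths [P1] from [x'] to [y] and
[P2] from [y'] to [z] are chosen short, so that a Hamilton path [P3] of the
remaining vertices can lead from [z'] to [x]. Inserting [v] between [x] and
[x'], or by the exchange at [y y'] and [z z'], gives two Hamilton cycles. Their
sums are 0, and they exceed the sum of D by the two sides. *)
Lemma pentagon_triangle v x x' y y' z' z :
    pentagon v y y' z' z -> e v x -> e v x' -> e x x' ->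
    x \notin [:: y; y'; z'; z] -> x' \notin [:: y; y'; z'; z] ->
  pentagon_sum v y y' z' z = cycle_sum w [:: v; x; x'].
Proof.
have a_gt0 := indep_gt0.
case/and5P=> evy eyy' ey'z' ez'z /and3P[ezv Up zN] evx evx' exx' xN x'N.
have neq (u1 u2 : T) : u1 != u2 -> (u1 == u2 = false) * (u2 == u1 = false).
  by rewrite [u2 == _]eq_sym => /negbTE.
move: (Up); rewrite /= !inE !negb_or -!andbA.
case/and5P=> /neq vy /neq vy' /neq vz' /neq yy' /and3P[/neq yz' /neq y'z' _].
move: zN xN x'N; rewrite !inE !negb_or.
case/and3P=> /neq zv /neq zy /neq zz'.
case/and4P=> /neq xy /neq xy' /neq xz' /neq xz.
case/and4P=> /neq x'y /neq x'y' /neq x'z' /neq x'z.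
have vx := neq _ _ (edge_neq evx); have vx' := neq _ _ (edge_neq evx').
have xx' := neq _ _ (edge_neq exx').
have simp := (vx, vx', xx', vy, vy', vz', yy', yz', y'z', zv, zy, zz',
  xy, xy', xz', xz, x'y, x'y', x'z', x'z).
have [|||P1 [eP1 lP1 UP1 X1 sP1]] := @short_path [:: v; x; y'; z'; z] x' y.
- by clear - ak a_gt0 => /=; lia.
- by rewrite !inE !simp.
- by rewrite !inE !simp.
have P1N u : u \in [:: v; x; y'; z'; z] -> u \in x' :: P1 = false.
  by move=> uX; apply/negP => /(allP X1); rewrite /= uX.
have [|||P2 [eP2 lP2 UP2 X2 sP2]] := @short_path [:: v, x, z', x' & P1] y' z.
- by clear - sP1 ak a_gt0; move: sP1 => /=; lia.
- by rewrite 3!in_cons P1N ?inE ?simp ?eqxx ?orbT.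
- by rewrite 3!in_cons P1N ?inE ?simp ?eqxx ?orbT.
have P2N u : u \in [:: v; x; z'] -> u \in y' :: P2 = false.
  rewrite !inE => uX; apply/negP => /(allP X2); rewrite /= 3!in_cons.
  by case/or3P: uX => ->; rewrite ?orbT.
have [||||P3 [eP3 lP3 UP3 X3]] := @ham_path (v :: (x' :: P1) ++ y' :: P2) z' x.
- by clear - sP1 sP2 ak a_gt0; move: sP1 sP2; rewrite /= size_cat /=; lia.
- by rewrite in_cons mem_cat P1N ?P2N ?inE ?simp ?eqxx ?orbT.
- by rewrite in_cons mem_cat P1N ?P2N ?inE ?simp ?eqxx ?orbT.
- by rewrite simp.
pose D := P1 ++ (y' :: P2) ++ z' :: P3.
have eD : path e x' D.
  by rewrite /D cat_path eP1 lP1 /= eyy' cat_path eP2 lP2 /= e_sym ez'z.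
have lD : last x' D = x by rewrite /D !last_cat.
have DE : x' :: D = ((x' :: P1) ++ y' :: P2) ++ z' :: P3.
  by rewrite /D -cat_cons catA.
have {}X3 u : (u \in z' :: P3) = (u \notin v :: (x' :: P1) ++ y' :: P2).
  exact: X3.
have UD : uniq (v :: x' :: D).
  have vE : v \notin (x' :: P1) ++ y' :: P2.
    by rewrite mem_cat P1N ?P2N ?inE ?eqxx.
  rewrite DE cons_uniq cat_uniq UP3 andbT mem_cat X3 negb_or negbK mem_head vE.
  rewrite cat_uniq UP1 UP2 !andTb !andbT.
  apply/andP; split; apply/hasPn => u.
    by move/(allP X2); rewrite /= 3!in_cons !negb_or => /and4P[].
  by rewrite X3 in_cons negb_or => /andP[].
have allD u : u \in v :: x' :: D.
  rewrite DE in_cons mem_cat X3 in_cons negb_or.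
  by case: (u == v); rewrite //= orbN.
have sumD : cycle_sum w (v :: x' :: D) = false.
  apply: spanning_cycle_sum => //.
  by rewrite /= evx' rcons_path eD lD e_sym.
pose D' := P1 ++ [:: v] ++ rev (y' :: P2) ++ z' :: P3.
have pD' : perm_eq (x' :: D') (v :: x' :: D).
  exact: (splice_perm x' P1 v [::] y' P2 z' P3).
have eD' : path e x' D' by apply: splice_path; rewrite //= ?lP1 ?lP2 // e_sym.
have lD' : last x' D' = x by rewrite /D' !(last_cat, last_cons).
have : cycle_sum w (x' :: D') = false.
  apply: spanning_cycle_sum.
  - by rewrite /= rcons_path eD' lD'.
  - by rewrite (perm_uniq pD').
  - by move=> u; rewrite (perm_mem pD').
move: sumD; rewrite /= !walk_sum_rcons lD lD' [walk_sum w x' D']splice_sum.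
rewrite lP1 lP2 -/D !(wC x) [w x' v]wC.
by case: (pentagon_sum _ _ _ _ _); xor_cases w.
Qed.

(** The common sum of all pentagons at [v]; see [pentagon_sum_tau]. *)
Definition tau v : bool :=
  [exists q : (T * T) * (T * T), pentagon v q.1.1 q.1.2 q.2.1 q.2.2 &&
    pentagon_sum v q.1.1 q.1.2 q.2.1 q.2.2].

(** Two pentagons at [v] are compared with a triangle that meets both only in
[v]. *)
Lemma pentagon_sum_tau v y y' z' z :
  pentagon v y y' z' z -> pentagon_sum v y y' z' z = tau v.
Proof.
move=> vP; apply/idP/existsP => [vS|[[[y1 y1'] [z1' z1]] /= /andP[vP1 vS1]]].
  by exists ((y, y'), (z', z)); rewrite vP.
have a_gt0 := indep_gt0.
have [|x [x' [evx evx' exx']]] :=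
    @triangle_avoiding ([:: y; y'; z'; z] ++ [:: y1; y1'; z1'; z1]) v.
  by move=> /=; lia.
rewrite !mem_cat => /norP[x1 x2] /norP[x1' x2'].
rewrite (pentagon_triangle vP evx evx' exx' x1 x1').
by rewrite -(pentagon_triangle vP1 evx evx' exx' x2 x2').
Qed.

(** All but [size X] of the at least [k] neighbours of [v] lie on [D], more than
[a] of them even without the last vertex of the list [D], which has no
successor in that list. *)
Lemma insert_vertex (X : seq T) v D :
    size X + a + 2 <= k -> v \notin X ->
    cycle e D -> uniq D -> D =i [predC v :: X] ->
  exists D', [/\ cycle e D', uniq D', D' =i [predC X]
    & cycle_sum w D' = cycle_sum w D (+) tau v].
Proof.
move=> Xk vX; case: D => [|s p] eD UD DX.
  have [|x [x' [evx _ _ xX _]]] := @triangle_avoiding X v; first by lia.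
  by have := DX x; rewrite in_nil !inE negb_or xX eq_sym edge_neq.
pose Y := ([set y | e v y] :\: [set y in X]) :\ last s p.
have [|||A [y' [B [z' [C [pE yY zY ey'z']]]]]] := @adjacent_successors s p Y UD.
- move=> y; rewrite !inE -in_cons DX !inE negb_or => /and3P[_ -> evy].
  by rewrite eq_sym edge_neq.
- by rewrite !inE eqxx.
- have := cardsD1 (last s p) ([set y | e v y] :\: [set y in X]); rewrite -/Y.
  have := leq_b1 (last s p \in [set y | e v y] :\: [set y in X]).
  have := degree_ge v; rewrite -(cardsID [set y in X] [set y | e v y]).
  have : #|[set y | e v y] :&: [set y in X]| <= size X.
    apply: leq_trans (card_size X); rewrite subset_leq_card //.
    by apply/subsetP => x; rewrite !inE => /andP[].
  by move: Xk; lia.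
have evy : e v (last s A) by move: yY; rewrite !inE => /and3P[].
have evz : e v (last y' B) by move: zY; rewrite !inE => /and3P[].
have ep : path e s p by move: eD; rewrite /= rcons_path => /andP[].
have pp := splice_perm s A v [::] y' B z' C; rewrite -pE in pp.
have vD : v \notin s :: p by rewrite DX !inE eqxx.
exists (s :: A ++ [:: v] ++ rev (y' :: B) ++ z' :: C); split.
- have lC : last s (A ++ [:: v] ++ rev (y' :: B) ++ z' :: C) = last s p.
    by rewrite pE !(last_cat, last_cons).
  rewrite -[cycle _ _]/(path e s (rcons _ s)) rcons_path lC; apply/andP; split.
    by apply: splice_path; rewrite -?pE // e_sym.
  by move: eD; rewrite /= rcons_path => /andP[].
- by rewrite (perm_uniq pp) /= -/(uniq (s :: p)) UD andbT.
- move=> u; rewrite (perm_mem pp) mem_cat mem_seq1 DX !inE negb_or.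
  by case: (eqVneq u v) => //= ->; rewrite vX.
have vP : pentagon v (last s A) y' z' (last y' B).
  move: (ep); rewrite pE cat_path /= cat_path /= => /and5P[_ eyy' _ ezz' _].
  move: UD vD; rewrite pE -cat_cons cat_uniq => /and3P[_ /hasPn sA _] vD.
  have yN u : u \in y' :: B ++ z' :: C -> last s A != u.
    by move/sA; apply: contraNneq => <-; rewrite mem_last.
  have vN u : u \in y' :: B ++ z' :: C -> v != u.
    by move=> uC; apply: contraNneq vD => ->; rewrite mem_cat uC orbT.
  have zC : last y' B \in y' :: B ++ z' :: C.
    by rewrite -cat_cons mem_cat mem_last.
  have z'C : z' \in y' :: B ++ z' :: C.
    by rewrite -cat_cons mem_cat mem_head orbT.
  have y'C : y' \in y' :: B ++ z' :: C by rewrite mem_head.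
  have ez'z : e z' (last y' B) by rewrite e_sym.
  have ezv : e (last y' B) v by rewrite e_sym.
  rewrite /pentagon evy eyy' ey'z' ez'z ezv /= !inE !negb_or edge_neq // !vN //.
  by rewrite !yN // ![last y' B == _]eq_sym yN // vN // !edge_neq.
rewrite -[LHS]/(walk_sum w s (rcons _ s)) walk_sum_rcons splice_sum -pE.
rewrite (pentagon_sum_tau vP) /= walk_sum_rcons pE !(last_cat, last_cons).
by rewrite addbAC.
Qed.

(** The vertices of [X] are absorbed one at a time, until a Hamilton cycle is
reached. *)
Lemma almost_spanning_cycle_sum X D :
    uniq X -> size X + a + 2 <= k -> cycle e D -> uniq D -> D =i [predC X] ->
  cycle_sum w D = \big[addb/false]_(v <- X) tau v.
Proof.
elim: X D => [|v X IHX] D.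
  move=> _ _ eD UD DX; rewrite big_nil.
  by apply: (spanning_cycle_sum eD UD) => v; rewrite DX.
case/andP=> vX UX Xk eD UD DX.
have [|D' [eD' UD' DX' sumD']] := insert_vertex _ vX eD UD DX.
  by move: Xk => /=; lia.
rewrite big_cons -(IHX D') // ?sumD' 1?addbC ?addbK //.
by move: Xk => /=; lia.
Qed.

(** * The weight is a coboundary up to a constant *)

(** A Hamilton path of G - [q] from [z'] to [z] becomes a cycle missing [q] when
closed by the edge [z z'], and a Hamilton cycle when closed by [q]. *)
Lemma short_cycle_sum z' z q :
    cycle e [:: z', z & q] -> uniq [:: z', z & q] -> size q + a + 2 <= k ->
  cycle_sum w [:: z', z & q] = \big[addb/false]_(v <- q) tau v.
Proof.
move=> eC UC qk; move: (eC) (UC) => /= /andP[ez'z eq].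
rewrite inE negb_or -andbA => /and4P[z'z z'q zq Uq].
have [p [ep lp Up pq]] := ham_path qk z'q zq z'z.
rewrite -(@almost_spanning_cycle_sum q (z' :: p)) //; last first.
  by rewrite /= rcons_path ep lp e_sym.
have : cycle_sum w (z' :: p ++ q) = false.
  apply: spanning_cycle_sum.
  - by rewrite /= rcons_cat cat_path ep lp.
  - rewrite -cat_cons cat_uniq Up Uq andbT.
    by apply/hasPn => u uq; rewrite pq inE uq.
  - by move=> u; rewrite -cat_cons mem_cat pq inE orNb.
rewrite /= rcons_cat walk_sum_cat (walk_sum_rcons w z' p) !lp [w z z']wC.
xor_cases w.
Qed.

(** On a short cycle through [x], [b], [y], apply [short_cycle_sum] at the edge
[x b] and at the edge [b y]: the sum of [tau] over all vertices but [x] and [b]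
is the same as over all vertices but [b] and [y]. *)
Lemma tau_common_neighbour b x y : e b x -> e b y -> tau x = tau y.
Proof.
move=> ebx eby; have a_gt0 := indep_gt0.
case: (eqVneq x y) => [-> //|xy].
have [|||p [ep lp Up bp sp]] := @short_path [:: b] y x.
- by move=> /=; lia.
- by rewrite inE eq_sym edge_neq.
- by rewrite inE eq_sym edge_neq.
case/lastP: p ep lp Up bp sp => [|r u].
  by move=> _ /= yx; rewrite yx eqxx in xy.
rewrite last_rcons => ep ux; rewrite {u}ux in ep *.
move=> Up bp; rewrite /= size_rcons => sp.
have Ub : uniq (b :: y :: rcons r x).
  by rewrite cons_uniq Up andbT; apply/negP => /(allP bp); rewrite /= inE eqxx.
have eb : cycle e (b :: y :: rcons r x).
  by rewrite /= eby rcons_path ep last_rcons e_sym.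
have rk : (size r).+1 + a + 2 <= k by clear - ak sp a_gt0; lia.
have rotE : rot 1 [:: x, b, y & r] = [:: b, y & rcons r x] by rewrite rot1_cons.
have : cycle_sum w [:: b, y & rcons r x] = cycle_sum w [:: x, b, y & r].
  by rewrite -rotE rot1_cons cycle_sum_rcons.
rewrite !short_cycle_sum ?size_rcons // -1?(rot_cycle 1) -1?(rot_uniq 1) ?rotE //.
rewrite big_rcons big_cons /=.
by case: (tau x); case: (tau y); case: (\big[addb/false]_(_ <- r) _).
Qed.

(** A triangle [u x x'] links the two ends: [u] and [x] are neighbours of [x'],
while [x] and [v] are neighbours of [u]. *)
Lemma tau_edge u v : e u v -> tau u = tau v.
Proof.
move=> euv; have a_gt0 := indep_gt0.
have [|x [x' [eux eux' exx' _ _]]] := @triangle_avoiding [::] u.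
  by move=> /=; lia.
rewrite (@tau_common_neighbour x' u x) 1?e_sym //.
exact: tau_common_neighbour eux euv.
Qed.

Lemma tau_const u v : tau u = tau v.
Proof.
have a_gt0 := indep_gt0.
have [|||p [ep <- _ _ _]] := @short_path [::] u v => //; first by move=> /=; lia.
elim: p u ep => //= y p IHp u /andP[/tau_edge-> /IHp].
by [].
Qed.

(** A cycle with r + 2 vertices has sum r * t by [short_cycle_sum], and adding
[t] to each weight cancels it, as r and r + 2 have the same parity. A closed walk
with a repeated vertex splits into two shorter ones. *)
Lemma short_closed_walk_sum0 t p : (forall v, tau v = t) ->
    size p <= 4 * a -> cycle e p ->
  cycle_sum (fun x y => w x y (+) t) p = false.
Proof.
set w' := fun x y => _.
move=> tauE; move: {2}(size p) (leqnn (size p)) => n; elim: n p => [|n IHn] p.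
  by rewrite leqn0 size_eq0 => /eqP->.
move=> pn pa ep; case: (boolP (uniq p)) => [Up|/not_uniq_split].
  case: p ep Up pa {pn} => [|x [|y q]] //; first by rewrite /= e_irr.
  move=> ep Up /= pa; have a_gt0 := indep_gt0.
  have sumE : \big[addb/false]_(v <- q) tau v = odd (size q) && t.
    elim: q {ep Up pa} => [|v q IHq]; first by rewrite big_nil.
    by rewrite big_cons IHq tauE /=; case: (odd _); case: (t).
  have qk : size q + a + 2 <= k by clear - ak a_gt0 pa; lia.
  move: (short_cycle_sum ep Up qk); rewrite sumE /= /w' walk_sum_shift size_rcons /=.
  by case: (w x y); case: (walk_sum w _ _); case: (odd _); case: (t).
case=> A [x [B [C pE]]]; pose D := x :: C ++ A.
have rotE : rot (size A) p = (x :: B) ++ D.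
  by rewrite pE rot_size_cat -catA.
have sumE : cycle_sum w' p = cycle_sum w' ((x :: B) ++ D).
  by rewrite pE cycle_sum_catC -catA.
have sp : size p = size (x :: B) + size D by rewrite -size_cat -rotE size_rot.
have : cycle e ((x :: B) ++ D) by rewrite -rotE rot_cycle.
rewrite sumE /= rcons_cat cat_path /= => /and3P[eB eBx eCA].
have eB' : cycle e (x :: B) by rewrite /= rcons_path eB.
have [n1 n2] : size (x :: B) <= n /\ size D <= n.
  by clear - sp pn; move: sp; rewrite /D /=; lia.
have [a1 a2] : size (x :: B) <= 4 * a /\ size D <= 4 * a by clear - sp pa; lia.
have := IHn (x :: B) n1 a1 eB'; rewrite [cycle_sum _ _]walk_sum_rcons => sB.
have sD : walk_sum w' x (rcons (C ++ A) x) = false := IHn D n2 a2 eCA.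
by rewrite walk_sum_cat /= sD addbF.
Qed.

(** The potential [g v] is the sum of w + t along a short path [P v] from a root
[r]. For an edge [u v], the paths [P u] and [P v] and the edge form a short
closed walk, so w + t is the difference of the potentials, which telescopes
around any closed walk. A Hamilton cycle then gives [t = 0] by parity. *)
Lemma closed_walk_sum0 p : odd #|T| -> cycle e p -> cycle_sum w p = false.
Proof.
move=> oddT ep; have a_gt0 := indep_gt0.
have /card_gt0P[r _] : 0 < #|T| by lia.
pose t := tau r; pose w' x y := w x y (+) t.
have w'C : symmetric w' by move=> x y; rewrite /w' wC.
have [|P PE] := @fin_all_exists T (fun=> seq T) (fun v p =>
    [/\ path e r p, last r p = v & size (r :: p) <= a.*2]).
  move=> v; have [||| q [eq lq _ _ sq]] := @short_path [::] r v => //.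
    by move=> /=; lia.
  by exists q.
pose g v := walk_sum w' r (P v).
have gE u v : e u v -> w' u v = g u (+) g v.
  move=> euv; have [eu lu su] := PE u; have [ev lv sv] := PE v.
  pose q := rev (belast r (P v)) ++ P u.
  have evr : path e v (rev (belast r (P v))) by rewrite -{1}lv rev_path_sym.
  have lvr : last v (rev (belast r (P v))) = r by rewrite -{1}lv last_rev_belast.
  have gv : walk_sum w' v (rev (belast r (P v))) = g v.
    by rewrite -{1}lv walk_sum_rev.
  have sumE : cycle_sum w' (v :: q) = g v (+) g u (+) w' u v.
    by rewrite [LHS]walk_sum_rcons walk_sum_cat last_cat gv lvr lu.
  have eq : cycle e (v :: q).
    by rewrite /= rcons_path cat_path last_cat evr lvr eu lu.
  have sq : size (v :: q) <= 4 * a.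
    rewrite /= /q size_cat size_rev size_belast.
    by clear - su sv; move: su sv => /=; lia.
  move: (short_closed_walk_sum0 (tau_const^~ r) sq eq); rewrite -/t -/w' sumE.
  by case: (g u); case: (g v); case: (w' u v).
have g_walk x q : path e x q -> walk_sum w' x q = g x (+) g (last x q).
  elim: q x => [|y q IHq] x /=; first by rewrite addbb.
  by case/andP=> /gE-> /IHq->; rewrite addbA -(addbA (g x)) addbb addbF.
have w'0 q : cycle e q -> cycle_sum w' q = false.
  by case: q => //= x q /g_walk->; rewrite last_rcons addbb.
(* On a Hamilton cycle both w and w + t have sum 0. *)
have t0 : t = false.
  have [|x [_ [erx _ _ _ _]]] := @triangle_avoiding [::] r; first by move=> /=; lia.
  have [||||q [eq lq Uq allq]] := @ham_path [::] x r => //.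
  - by move=> /=; lia.
  - by rewrite eq_sym edge_neq.
  have eC : cycle e (x :: q) by rewrite /= rcons_path eq lq.
  have sq : size (x :: q) = #|T|.
    by rewrite -(card_uniqP Uq); apply: eq_card => v; rewrite allq.
  have := w'0 _ eC; rewrite [cycle_sum _ _]walk_sum_shift -/t size_rcons.
  rewrite -[walk_sum _ _ _]/(cycle_sum w (x :: q)) (ham0 eC Uq sq).
  by rewrite -[(size q).+1]/(size (x :: q)) sq oddT.
have := w'0 _ ep; case: p ep => //= x q _.
by rewrite /= walk_sum_shift -/t t0 andbF addbF.
Qed.

End NullHamiltonCycles.

End HighlyConnected.

(** * Duality *)

Import Order.TTheory GRing.Theory Num.Theory.
Local Open Scope ring_scope.

Section Duality.

Lemma F2_neq0_add (x y : 'F_2) : (x + y != 0) = (x != 0) (+) (y != 0).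
Proof. by case: x => -[|[|m]] ?; case: y => -[|[|n]] ?. Qed.

(** Otherwise [x] and [y] would be successors of each other, and the cycle would
have length two. *)
Lemma edge_of_cycle_inj (T : eqType) (p : seq T) : uniq p -> (2 < size p)%N ->
  {in p &, forall x y, (x == y) || (x == next p y) && (y == next p x) -> x = y}.
Proof.
move=> Up p3 x y xp yp /orP[/eqP // | /andP[/eqP xE /eqP yE]].
case: (rot_to xp) => i q pE.
have nE : next p =1 next (x :: q) by move=> u; rewrite -pE next_rot.
have : (2 < size (x :: q))%N by rewrite -pE size_rot.
have : uniq (x :: q) by rewrite -pE rot_uniq.
move: xE yE; rewrite !nE; case: q {pE nE} => [|u [|v q]] //=.
rewrite (eqxx x) /= => xE yE; move: xE; rewrite yE (eqxx u) /= !inE.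
by case: (eqVneq u x) => [-> //|_ ->]; rewrite !eqxx ?orbT.
Qed.

Variables (T : finType) (e : rel T).

Lemma cycle_incidence (p : seq T) : uniq p -> (2 < size p)%N ->
  incidence_vector e (cycle_edges p) =
    \sum_(x <- p) incidence_vector e [set [set x; next p x]].
Proof.
move=> Up p3; apply/ffunP => f; rewrite sum_ffunE ffunE.
have h_inj : {in p &, injective (fun x => [set x; next p x])}.
  move=> x y xp yp /setP hE; apply: (edge_of_cycle_inj Up p3 xp yp).
  have := hE x; have := hE y; rewrite !inE !eqxx /= [y == x]eq_sym.
  by case: (x == y) => //= -> <-.
under eq_bigr => x _ do rewrite ffunE inE.
rewrite big_uniq //= /cycle_edges.
case: imsetP => [[x xp fE]|nf].
  rewrite (bigD1 x) //= fE eqxx big1 ?addr0 // => y /andP[yp yx].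
  by rewrite (inj_in_eq h_inj) // eq_sym (negbTE yx).
rewrite big1 // => x xp; case: eqP => // fE; case: nf; by exists x.
Qed.

(** The map [x - projv U x] kills [U] but not [v], so one of its coordinates is
such a functional. *)
Lemma functional_separation (U : {vspace {ffun edge e -> ('F_2)^o}}) v :
  v \notin U -> exists phi : {ffun edge e -> ('F_2)^o} -> 'F_2,
   [/\ {morph phi : x y / x + y}, phi 0 = 0,
     forall u, u \in U -> phi u = 0 & phi v != 0].
Proof.
move=> vU; have : v - projv U v != 0.
  by apply: contra vU; rewrite subr_eq0 => /eqP->; apply: memv_proj.
move=> nz; have [f nzf] : exists f, (v - projv U v) f != 0.
  apply/existsP; apply: contraNT nz; rewrite negb_exists => /forallP z.
  apply/eqP/ffunP => f; rewrite [RHS]ffunE; apply/eqP.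
  by have := z f; rewrite negbK.
exists (fun x => (x - projv U x) f); split=> //.
- by move=> x y; rewrite linearD /= opprD addrACA ffunE.
- by rewrite linear0 subr0 ffunE.
- by move=> u uU; rewrite projv_id // subrr ffunE.
Qed.

End Duality.

Theorem theorem1p2 (R : realType) :
  exists (c : R) (n0 : nat),
    forall (T : finType) (e : rel T),
      symmetric e -> irreflexive e ->
      (n0 <= #|T|)%N -> odd #|T| ->
      (c * Num.max (independence_number e)%:R (ln #|T|%:R)
         <= (connectivity e)%:R
       \/ c * (independence_number e)%:R ^+ 2 <= (connectivity e)%:R) ->
      cycle_space_of_length e #|T| = cycle_space e.
Proof.
exists 20%:R, 0%N => T e e_sym e_irr _ oddT kappa_ge.
set a := independence_number e in kappa_ge.
set k := connectivity e in kappa_ge.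
have indep_le S : independent e S -> (#|S| <= a)%N.
  by move=> Si; apply: (leq_bigmax_cond S Si).
have T_gt0 : (0 < #|T|)%N by case: #|T| oddT.
have [k_lt conn] : (k < #|T|)%N /\
    forall S : {set T}, (#|S| < k)%N -> connected_minus e S.
  suff /andP[klt /forallP kC] : k_connected e k.
    by split=> // S; apply/implyP/kC.
  have [|i ki kE] :=
      @eq_bigmax_cond _ (fun i : 'I_#|T| => k_connected e i) (fun i => i : nat).
    apply/card_gt0P; exists (Ordinal T_gt0).
    rewrite unfold_in /k_connected /= T_gt0.
    exact/forallP.
  by rewrite /k /connectivity kE.
have a_gt0 : (0 < a)%N.
  have /card_gt0P[x _] := T_gt0; rewrite -(cards1 x); apply: indep_le.
  apply/forall_inP => u /set1P->; apply/forall_inP => v /set1P->.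
  by rewrite e_irr.
have ak : (20 * a <= k)%N.
  rewrite -(ler_nat R) natrM; case: kappa_ge => kappa_ge.
    apply: le_trans kappa_ge; rewrite ler_pM2l ?ltr0n //.
    by rewrite le_max lexx.
  apply: le_trans kappa_ge; rewrite ler_pM2l ?ltr0n // expr2 ler_peMl ?ler0n //.
  by rewrite ler1n.
apply/eqP; rewrite eqEsubv; apply/andP; split.
  apply/span_subvP => u /imageP[C Cn ->]; apply/memv_span/imageP.
  exists C => //; apply/bigcupP.
  by exists (Ordinal (ltnSn #|T|)).
apply/span_subvP => u /imageP[C /bigcupP[n _ /imsetP[p]]].
rewrite inE => /andP[n2 /andP[ep Up]] -> ->; apply: contraT => pU.
have [phi [phiD phi0 phiU]] := functional_separation pU.
pose w x y := phi (incidence_vector e [set [set x; y]]) != 0.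
have wC : symmetric w by move=> x y; rewrite /w setUC.
have phi_cycle q : uniq q -> (2 < size q)%N ->
    (phi (incidence_vector e (cycle_edges q)) != 0) = cycle_sum w q.
  move=> Uq q2; rewrite cycle_incidence // (big_morph phi phiD phi0).
  rewrite (big_morph _ F2_neq0_add (_ : (0 != 0) = false)) ?eqxx //.
  exact: cycle_sum_next.
rewrite phi_cycle ?size_tuple //.
rewrite (closed_walk_sum0 e_sym e_irr indep_le conn k_lt ak wC) //.
move=> q eq Uq qT; have q2 : (2 < size q)%N by rewrite qT; lia.
rewrite -phi_cycle // phiU ?eqxx //; apply/memv_span/imageP.
exists (cycle_edges q) => //; apply/imsetP.
have /eqP qT' := qT; exists (Tuple qT') => //.
by rewrite inE; apply/andP; split; [rewrite -qT | rewrite /ucycleb /= eq].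
Qed.
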